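(* Let $G$ be a graph with strong blocks $\{G_e:e\in E\}$ and additive-multiplicative block-datum $\mathcal{G}=\{(a_e,D^*_{G_e}):e\in E\}$ over a commutative unital ring $R$, and assume that the matrices $D_{\mathcal{G}}$ and $D^*_G$ are invertible. Then $$D_{\mathcal{G}}^{-1}=\frac{\kappa(D_{\mathcal{G}})}{\det(D_{\mathcal{G}})}\,\boldsymbol{\tau}_{\rm out}\boldsymbol{\tau}_{\rm in}^T+C_{\mathcal{G}}(D^*_G)^{-1}.$$
   Context: Graphs are finite, simple, directed and strongly connected (there are directed paths between any two distinct vertices). A cut-vertex is a vertex whose removal disconnects the underlying undirected graph; the strong blocks of $G$ are its maximal (connected) subgraphs without cut-vertices of their own. $E$ indexes the strong blocks $G_e$ of $G$; $V(G_e)$ is the vertex set of $G_e$ and $p_e=|V(G_e)|$. $\mathbf{e}$ denotes an all-ones column vector and $J=\mathbf{e}\mathbf{e}^T$ an all-ones square matrix, of the dimension dictated by context. Additive-multiplicative block-datum: a family $\mathcal{G}=\{\mathcal{G}_e=(a_e,D^*_{G_e}):e\in E\}$ with $a_e\in R$ and $D^*_{G_e}\in R^{p_e\times p_e}$ a matrix (rows and columns indexed by $V(G_e)$) with all diagonal entries equal to $1$ (otherwise arbitrary). Multiplicative distance matrix $D^*_G=(m_{ij})_{i,j\in V(G)}$: its principal submatrix on $V(G_e)$ is $D^*_{G_e}$, and for $i,j$ not in a common block, inductively $m_{ij}:=m_{iv}m_{vj}$ where $v\neq i,j$ is any cut-vertex separating $i$ from $j$ (independent of the choice of $v$). Additive-multiplicative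 distance matrix $D_{\mathcal{G}}=(d_{ij})_{i,j\in V(G)}$: its principal submatrix on $V(G_e)$ is $D_{\mathcal{G}_e}:=a_e(D^*_{G_e}-J)$, and for $i,j$ not in a common block, inductively $d_{ij}:=d_{iv}+m_{iv}d_{vj}$ where $v\neq i,j$ is any cut-vertex separating $i$ from $j$ (independent of the choice of $v$). Set $\kappa(D_{\mathcal{G}}):=\det(D^*_G)\prod_{e\in E}a_e^{p_e-1}$ and $\kappa(D_{\mathcal{G}_e}):=a_e^{p_e-1}\det(D^*_{G_e})$. (When $D_{\mathcal{G}}$ and $D^*_G$ are invertible, all $a_e$, all $D^*_{G_e}$, and hence all these $\kappa$'s are invertible.) Define $\boldsymbol{\tau}_{\rm in}^T:=\mathbf{e}^T(D^*_G)^{-1}$ and $\boldsymbol{\tau}_{\rm out}:=(D^*_G)^{-1}\mathbf{e}$. Given a node $i$ lying in a strong block $e\in E$, let $G_{i\to e}$ be the unique maximum induced subgraph of $G$ that contains the block $e$ and for which $i$ is not a cut-vertex. For $i\in V(G)$ define $$\beta_i:=\frac{\kappa(D_{\mathcal{G}})}{\det(D_{\mathcal{G}})}\sum_{e\in E:\,i\in e}\frac1{a_e}\sum_{f\in E:\,f\subseteq G_{i\to e}}\frac{\det(D_{\mathcal{G}_f})}{\kappa(D_{\mathcal{G}_f})},$$ and define the matrix $C_{\mathcal{G}}\in R^{V(G)\times V(G)}$ by $(C_{\mathcal{G}})_{ii}:=\beta_i$, and $(C_{\mathcal{G}})_{ij}:=\beta_i-\frac{1}{a_e}$ if $j\ne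 i$ and $j\in G_{i\to e}$ (with $e$ a block containing $i$; such $e$ is unique). *)

(* Defs.v *)
From mathcomp Require Import all_boot all_algebra.

Set Implicit Arguments.
Unset Strict Implicit.
Unset Printing Implicit Defensive.

Import GRing.Theory.

Section Graph.

Variables (V : finType) (g : rel V).

(* A digraph is a relation [g]; subgraphs are represented by their vertex
   sets, i.e. all subgraphs are induced.  This loses nothing for blocks: adding
   edges creates no cut-vertex, so a maximal subgraph without cut-vertices is
   induced.  Connectivity of subgraphs is that of the underlying undirected
   graph; in a strongly connected digraph the blocks of the underlying graph are
   themselves strongly connected. *)
Definition strongly_connected : Prop := forall x y : V, connect g x y.

Definition undirected_on (S : {set V}) : rel V :=
  [rel x y | [&& x \in S, y \in S & g x y || g y x]].

Definition connected_on (S : {set V}) : bool :=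
  [forall x in S, forall y in S, connect (undirected_on S) x y].

Definition cut_vertex (S : {set V}) (v : V) : bool :=
  [&& v \in S, connected_on S & ~~ connected_on (S :\ v)].

Definition strong_blocks : {set {set V}} :=
  [set B | maxset [pred S | [&& S != set0, connected_on S
                              & [forall v, ~~ cut_vertex S v]]] B].

Definition separates (v i j : V) : bool :=
  [&& v != i, v != j, cut_vertex setT v
    & ~~ connect (undirected_on (setT :\ v)) i j].

(* [branch i B] is the vertex set of G_{i -> B}: for a block [B] containing [i]
   the maximum is unique, being [i] plus the component of [G - i] that meets
   [B]. *)
Definition branch (i : V) (B : {set V}) : {set V} :=
  [arg max_(S > B | [&& B \subset S, connected_on S & ~~ cut_vertex S i])
    #|S|]%N.

End Graph.

Local Open Scope ring_scope.

Section Distance.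

(* The datum of the block with vertex set [B] is [a B] and the restriction of
   [Ms B] to [B * B]; the other entries of [Ms B], and the values of [a] and
   [Ms] at sets which are not strong blocks, are never used. *)
Variables (R : comUnitRingType) (n : nat) (g : rel 'I_n).
Variables (a : {set 'I_n} -> R) (Ms : {set 'I_n} -> 'M[R]_n).

Definition unit_diagonals : Prop :=
  forall B i, B \in strong_blocks g -> i \in B -> Ms B i i = 1.

Definition common_block (i j : 'I_n) : option {set 'I_n} :=
  [pick B in strong_blocks g | (i \in B) && (j \in B)].

(* The recursion has [k] as fuel. [n] units of fuel are enough: when [v]
   separates [i] from [j], the vertices separating [i] from [v], and those
   separating [v] from [j], are proper subsets of those separating [i]
   from [j]. The value does not depend on which [v] is picked. The defaults 0 are never reached in a connected graph. *)
Fixpoint mult_dist_rec (k : nat) (i j : 'I_n) : R :=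
  if common_block i j is Some B then Ms B i j
  else if k is k'.+1 then
    if [pick v | separates g v i j] is Some v
    then mult_dist_rec k' i v * mult_dist_rec k' v j else 0
  else 0.

Definition mult_dist_mx : 'M[R]_n := \matrix_(i, j) mult_dist_rec n i j.

Fixpoint addmult_dist_rec (k : nat) (i j : 'I_n) : R :=
  if common_block i j is Some B then a B * (Ms B i j - 1)
  else if k is k'.+1 then
    if [pick v | separates g v i j] is Some v
    then addmult_dist_rec k' i v + mult_dist_mx i v * addmult_dist_rec k' v j
    else 0
  else 0.

Definition addmult_dist_mx : 'M[R]_n := \matrix_(i, j) addmult_dist_rec n i j.

Definition block_mult_mx (B : {set 'I_n}) : 'M[R]_#|B| :=
  \matrix_(p, q) Ms B (enum_val p) (enum_val q).

Definition block_addmult_mx (B : {set 'I_n}) : 'M[R]_#|B| :=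
  a B *: (block_mult_mx B - const_mx 1).

Definition kappa : R :=
  \det mult_dist_mx * \prod_(B in strong_blocks g) a B ^+ (#|B| - 1).

Definition block_kappa (B : {set 'I_n}) : R :=
  a B ^+ (#|B| - 1) * \det (block_mult_mx B).

Definition tau_in_tr : 'rV[R]_n := const_mx 1 *m invmx mult_dist_mx.

Definition tau_out : 'cV[R]_n := invmx mult_dist_mx *m const_mx 1.

Definition beta (i : 'I_n) : R :=
  kappa / \det addmult_dist_mx *
  \sum_(B in strong_blocks g | i \in B)
    (a B)^-1 * \sum_(F in strong_blocks g | F \subset branch g i B)
                 \det (block_addmult_mx F) / block_kappa F.

(* For [j != i] there is exactly one block [B] as in the [pick]. *)
Definition C_mx : 'M[R]_n :=
  \matrix_(i, j)
    if j == i then beta i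
    else if [pick B in strong_blocks g | (i \in B) && (j \in branch g i B)]
            is Some B
         then beta i - (a B)^-1 else 0.

End Distance.

(* Main.v *)
(* Every vertex i has a gate in every block B, the vertex of B at which all walks
   from i enter B. Write M for D*_G, with block restrictions M_B, and g_B(i) for
   the gate. Then m_ij is the product over all B of M_B(g_B i, g_B j), and d_ij
   the sum over all B of m_(i, g_B i) a_B (M_B(g_B i, g_B j) - 1).
   If y_B (block_tau) solves M_B y_B = 1, then D = M W with W (gate_mx) given by
     W_jk = sum over B containing j of a_B ([g_B k = j] - y_B(j)),
   and (tau_out)_j = 1 + sum over B containing j of (y_B(j) - 1).
   Every column of W sums to lambda = sum_B a_B (1 - sum y_B), whose terms are
   the det(D_B) / kappa(D_B), so tau_in^T D = lambda e^T. A direct count over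
   the branches at a vertex gives C W = I - tau_out e^T. Row and column
   operations make W triangular for the order in which a vertex separates others
   from a root, whence det W = lambda prod_B a_B^(p_B - 1) and
   det D = kappa(D) lambda; this supplies the needed invertibility. *)

Require Import Defs.
From mathcomp Require Import all_boot all_algebra fingroup perm.

Set Implicit Arguments.
Unset Strict Implicit.
Unset Printing Implicit Defensive.

Import GRing.Theory.
Local Open Scope ring_scope.

(** * Gates of blocks *)

Section Gates.

Local Open Scope nat_scope.

Variables (V : finType) (g : rel V).

Local Notation adj := (fun x y => g x y || g y x).
Local Notation conn S := (connect (undirected_on g S)).

(** * Connectivity inside vertex sets, and blocks *)

Lemma conn_sym (S : {set V}) x y : conn S x y = conn S y x.
Proof.
apply: sym_connect_sym => {}x {}y.
by rewrite /undirected_on /= andbCA orbC.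
Qed.

Lemma connS (S T : {set V}) x y : S \subset T -> conn S x y -> conn T x y.
Proof.
move=> /subsetP ST; apply: connect_sub => u v /and3P[/ST uT /ST vT uv].
by apply: connect1; apply/and3P.
Qed.

Lemma conn_adj (S : {set V}) x y : x \in S -> y \in S -> adj x y -> conn S x y.
Proof. by move=> xS yS xy; apply: connect1; apply/and3P. Qed.

Lemma conn_mem (S : {set V}) x y : conn S x y -> x != y -> (x \in S) && (y \in S).
Proof.
move=> xy nxy; apply/andP; split.
  case/connectP: xy => -[|z p] /=; first by move=> _ e; rewrite e eqxx in nxy.
  by case/andP => /and3P[].
move: xy; rewrite conn_sym => /connectP[[|z p]] /=.
  by move=> _ e; rewrite e eqxx in nxy.
by case/andP => /and3P[].
Qed.

Lemma conn_path (S : {set V}) e x p :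
  path (undirected_on g e) x p -> {subset x :: p <= S} -> conn S x (last x p).
Proof.
move=> xp sub; apply/connectP; exists p => //.
elim: p x xp sub => //= z p IH x /andP[/and3P[_ _ xz] zp] sub.
rewrite IH // ?andbT; last by move=> u up; apply: sub; rewrite inE up orbT.
by apply/and3P; split=> //; apply: sub; rewrite !inE eqxx ?orbT.
Qed.

Lemma conn_avoid (S : {set V}) k x y :
  conn S x y -> ~~ conn S x k -> conn (S :\ k) x y.
Proof.
case/connectP => p; elim: p x => [|z p IH] x /=; first by move=> _ -> _.
case/andP=> xz zp ey nxk; have cxz: conn S x z by apply: connect1.
have nzk : ~~ conn S z k.
  by apply: contra nxk => /(connect_trans cxz).
apply: connect_trans (IH _ zp ey nzk); case/and3P: xz => xS zS xz.
apply: conn_adj; rewrite // !inE ?xS ?zS andbT.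
  by apply: contraNneq nxk => ->; apply: connect0.
by apply: contraNneq nzk => ->; apply: connect0.
Qed.

(** Here [b] is the first vertex of the walk that lies in [B], and [c] is its predecessor. *)
Lemma conn_exit (S B : {set V}) x y :
  x \notin B -> y \in B -> conn S x y ->
  exists c b, [/\ c \notin B, b \in B :&: S, adj c b & conn (S :\: B) x c].
Proof.
move=> xB yB /connectP[p]; elim: p x xB => [|z p IH] x xB /=.
  by move=> _ e; rewrite -e yB in xB.
case/andP=> /and3P[xS zS xz] zp ey; have [zB|zB] := boolP (z \in B).
  by exists x, z; rewrite inE zB; split.
have [c [b [cB bB cb zc]]] := IH z zB zp ey.
exists c, b; split=> //; apply: connect_trans zc.
by apply: conn_adj; rewrite // inE ?xB ?zB.
Qed.

Lemma connected_onP (S : {set V}) :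
  reflect {in S &, forall x y, conn S x y} (connected_on g S).
Proof.
apply: (iffP forall_inP) => [h x y xS yS | h x xS].
  by move/forall_inP: (h x xS); apply.
by apply/forall_inP => y yS; apply: h.
Qed.

Lemma connected_on_via (B S : {set V}) : B \subset S -> connected_on g B ->
  {in S, forall x, exists2 b, b \in B & conn S x b} -> connected_on g S.
Proof.
move=> BS /connected_onP cB h; apply/connected_onP => x y.
move=> /h[b bB xb] /h[c cC]; rewrite conn_sym; apply: connect_trans.
by apply: (connect_trans xb); apply: connS (cB _ _ bB cC).
Qed.

Lemma connected_onU (S T : {set V}) z : z \in S -> z \in T ->
  connected_on g S -> connected_on g T -> connected_on g (S :|: T).
Proof.
move=> zS zT cS /connected_onP cT; apply: connected_on_via cS _.
  exact: subsetUl.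
move=> x /setUP[xS|xT]; first by exists x; rewrite ?connect0.
by exists z => //; apply: connS (cT _ _ xT zT); apply: subsetUr.
Qed.

(** Absence of cut-vertices with [v] ranging over all vertices: for [v] outside [S], the set
    [S :\ v] is [S] itself. *)
Definition biconnected (S : {set V}) :=
  [&& S != set0, connected_on g S & [forall v, connected_on g (S :\ v)]].

Lemma strong_blocksE B :
  (B \in strong_blocks g) = maxset biconnected B.
Proof.
rewrite inE; apply/maxsetP/maxsetP => -[].
all: have E S : biconnected S = [&& S != set0, connected_on g S
   & [forall v, ~~ cut_vertex g S v]].
all: try by rewrite /biconnected; case: (S != set0) => //=;
  have [cS|//] := boolP (connected_on g S); apply: eq_forallb => v;
  rewrite /cut_vertex cS; have [vS|vS] := boolP (v \in S); rewrite ?negbK //;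
  rewrite (setDidPl _) ?cS // disjoint_sym disjoints1.
all: by move=> + h; rewrite /= ?E => bB; split; rewrite /= ?E // => S;
  move: (h S); rewrite /= E.
Qed.

Lemma biconnected_sub S : biconnected S ->
  exists2 B, B \in strong_blocks g & S \subset B.
Proof.
by move=> /maxset_exists[B mB sB]; exists B; rewrite ?strong_blocksE.
Qed.

Lemma block_biconnected B : B \in strong_blocks g -> biconnected B.
Proof. by rewrite strong_blocksE => /maxsetp. Qed.

Lemma block_connected B : B \in strong_blocks g -> connected_on g B.
Proof. by move=> /block_biconnected/and3P[]. Qed.

Lemma block_connectedD1 B v : B \in strong_blocks g -> connected_on g (B :\ v).
Proof. by move=> /block_biconnected/and3P[_ _ /forallP]. Qed.

Lemma block_neq0 B : B \in strong_blocks g -> B != set0.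
Proof. by move=> /block_biconnected/and3P[]. Qed.

Lemma block_max B S :
  B \in strong_blocks g -> biconnected S -> B \subset S -> S = B.
Proof. by rewrite strong_blocksE => mB bS BS; apply: (maxsetsup mB). Qed.

Lemma biconnected2 u w : adj u w -> biconnected [set u; w].
Proof.
move=> uw; have h (S : {set V}) : S \subset [set u; w] -> connected_on g S.
  move/subsetP=> sS; apply/connected_onP => x y xS yS.
  have [->|nxy] := eqVneq x y; first exact: connect0.
  apply: conn_adj => //; move: nxy (sS _ xS) (sS _ yS); rewrite !inE.
  move=> nxy /orP[]/eqP ex /orP[]/eqP ey; subst x y; rewrite ?eqxx // in nxy *.
  by rewrite orbC.
apply/and3P; split; last by apply/forallP => v; rewrite h ?subsetDl.
  by apply/set0Pn; exists u; rewrite set21.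
exact: h.
Qed.

Lemma biconnected1 u : biconnected [set u].
Proof.
have h (S : {set V}) : S \subset [set u] -> connected_on g S.
  move/subsetP=> sS; apply/connected_onP => x y /sS/set1P-> /sS/set1P->.
  exact: connect0.
apply/and3P; split; last by apply/forallP => v; rewrite h ?subsetDl.
  by apply/set0Pn; exists u; rewrite set11.
exact: h.
Qed.

Lemma block_exists u : exists2 B, B \in strong_blocks g & u \in B.
Proof.
have [B bB uB] := biconnected_sub (biconnected1 u).
by exists B; rewrite // -sub1set.
Qed.

(** One of two shared vertices survives any deletion and still joins both halves, so the union is
    biconnected and maximality identifies it with each block. *)
Lemma block_eq A B x y : A \in strong_blocks g -> B \in strong_blocks g ->
  x \in A -> x \in B -> y \in A -> y \in B -> x != y -> A = B.
Proof.
move=> bA bB xA xB yA yB nxy.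
suff bU : biconnected (A :|: B).
  by rewrite -(block_max bA bU (subsetUl _ _)) (block_max bB bU (subsetUr _ _)).
apply/and3P; split.
- by apply/set0Pn; exists x; rewrite inE xA.
- by apply: connected_onU xA xB _ _; apply: block_connected.
apply/forallP => v; rewrite setDUl.
have [z zv zAB]: exists2 z, z != v & (z \in A) && (z \in B).
  have [<-|xv] := eqVneq x v; first by exists y; rewrite ?yA // eq_sym.
  by exists x; rewrite ?xA.
have [zA zB] := andP zAB.
by apply: (@connected_onU _ _ z); rewrite ?inE ?zv //; apply: block_connectedD1.
Qed.

(* Otherwise adding to B a path joining c to c' outside B keeps it biconnected. *)
Lemma block_ear B b b' c c' : B \in strong_blocks g ->
  b \in B -> b' \in B -> c \notin B -> c' \notin B ->
  adj c b -> adj c' b' -> conn (~: B) c c' -> b = b'.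
Proof.
move=> bB bI b'I cB c'B cb c'b' /connectP[p0 p0P e]; subst c'.
have [//|nbb'] := eqVneq b b'.
case/shortenP: p0P c'B c'b' => p pp up _ c'B c'b'.
have pB : {subset c :: p <= ~: B}.
  have all_in : forall q x, x \notin B -> path (undirected_on g (~: B)) x q ->
      {subset x :: q <= ~: B}.
    elim=> [|z q IH] x xB /=; first by move=> _ u; rewrite !inE => /eqP->.
    case/andP => /and3P[_ zB _] zq u; rewrite inE => /predU1P[->|].
      by rewrite inE.
    by apply: IH; rewrite // -in_setC.
  exact: all_in.
pose S := B :|: [set x in c :: p].
have cov v x : x \in c :: p -> x != v ->
    exists2 z, z \in B :\ v & conn (S :\ v) x z.
  move=> xp nxv; case/splitPl: xp pp up pB @S c'B c'b' => p1 p2 p1x.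
  rewrite cat_path last_cat p1x => /andP[pp1 pp2] up pB S c'B c'b'.
  (* The path is simple, so the deleted [v] lies on at most one side of [x]: go back to [b] if [v]
     is not on that side, and forward to [b'] otherwise. *)
  have [vp|vp] := boolP (v \in b :: c :: p1); last first.
    move: (vp); rewrite inE negb_or eq_sym => /andP[nbv vp1].
    exists b; first by rewrite !inE nbv.
    rewrite conn_sym; apply: (@connect_trans _ _ c).
      apply: conn_adj; rewrite 1?orbC // !inE ?nbv ?bI ?eqxx ?orbT ?andbT //.
      by apply: contraNneq vp1 => <-; rewrite mem_head.
    rewrite -p1x; apply: conn_path pp1 _ => u up1.
    rewrite !inE mem_cat; apply/andP; split.
      by apply: contraNneq vp1 => <-.
    by move: up1; rewrite inE => /predU1P[->|->]; rewrite ?eqxx ?orbT.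
  have vp2 : v \notin x :: p2.
    rewrite inE negb_or eq_sym nxv /=; apply/negP => vp2.
    move: vp; rewrite inE => /predU1P[e|vp1].
      have := pB v; rewrite -cat_cons mem_cat vp2 orbT => /(_ isT).
      by rewrite e inE bI.
    by move: up; rewrite -cat_cons cat_uniq => /and3P[_ /hasPn/(_ v vp2)/negP].
  have nb'v : b' != v.
    apply: contraTneq vp => <-; rewrite inE eq_sym (negPf nbb') /=.
    apply/negP => h; have := pB b'; rewrite -cat_cons mem_cat h => /(_ isT).
    by rewrite inE b'I.
  exists b'; first by rewrite !inE nb'v.
  have xs : {subset x :: p2 <= S :\ v}.
    move=> u up2; rewrite !inE; apply/andP; split.
      by apply: contraNneq vp2 => <-.
    rewrite -in_cons -cat_cons mem_cat; move: up2.
    by rewrite inE => /predU1P[->|->]; rewrite ?orbT // -p1x mem_last orbT.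
  apply: connect_trans (conn_path pp2 xs) _; apply: conn_adj => //.
    by apply: xs; rewrite mem_last.
  by rewrite !inE nb'v b'I.
have bS : biconnected S.
  have h v : connected_on g (S :\ v).
    apply: connected_on_via (block_connectedD1 v bB) _.
      by apply: setSD; apply: subsetUl.
    move=> x; rewrite in_setD1 => /andP[xv /setUP[xB|xp]].
      by exists x; rewrite ?connect0 // in_setD1 xv.
    by apply: cov; rewrite // inE in xp.
  apply/and3P; split; last exact/forallP.
    by apply/set0Pn; exists b; rewrite inE bI.
  apply: connected_on_via (block_connected bB) _; first exact: subsetUl.
  move=> x /setUP[xB|xp]; first by exists x; rewrite ?connect0.
  rewrite in_set in xp; have nxb : x != b.
    by apply: contraTneq (pB x xp) => ->; rewrite inE bI.
  have [z zB xz] := cov b x xp nxb.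
  by exists z; [case/setD1P: zB | apply: connS xz; apply: subsetDl].
have := block_max bB bS (subsetUl _ _) => /setP/(_ c).
by rewrite !inE eqxx orbT (negPf cB).
Qed.

(* [b] is the vertex where walks from [x] first meet [B]. *)
Definition is_gate (B : {set V}) x b := (b \in B) && (if x \in B then x == b
  else [exists c, [&& c \notin B, adj c b & conn (~: B) x c]]).

Lemma is_gate_uniq B x b b' : B \in strong_blocks g ->
  is_gate B x b -> is_gate B x b' -> b = b'.
Proof.
move=> bB; rewrite /is_gate; case: ifP => _ /andP[bI hb] /andP[b'I].
  by move/eqP: hb => <- /eqP->.
case/existsP: hb => c /and3P[cB cb xc] /existsP[c' /and3P[c'B c'b' xc']].
apply: block_ear bB bI b'I cB c'B cb c'b' _.
by rewrite conn_sym in xc; apply: connect_trans xc xc'.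
Qed.

(** The default [x] is never reached for a block of a strongly connected graph. *)
Definition gate B x := odflt x [pick b | is_gate B x b].

(** * Gates in a strongly connected graph *)

Hypothesis g_strong : strongly_connected g.

Lemma connT x y : conn setT x y.
Proof.
apply: connect_sub (g_strong x y) => u v uv.
by apply: conn_adj; rewrite ?inE ?uv.
Qed.

Lemma gateP B x : B \in strong_blocks g -> is_gate B x (gate B x).
Proof.
move=> bB; rewrite /gate; case: pickP => //= no.
have /set0Pn[y yB] := block_neq0 bB.
have [xB|xB] := boolP (x \in B); first by have := no x; rewrite /is_gate xB eqxx.
have [c [b [cB /setIP[bI _] cb xc]]] := conn_exit xB yB (connT x y).
have := no b; rewrite /is_gate bI (negPf xB) => /existsP[]; exists c.
by rewrite cB cb -setTD.
Qed.

Lemma gateE B x b : B \in strong_blocks g -> is_gate B x b -> gate B x = b.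
Proof. by move=> bB; apply: (is_gate_uniq bB (gateP x bB)). Qed.

Lemma gate_in B x : B \in strong_blocks g -> gate B x \in B.
Proof. by move/(gateP x)/andP=> []. Qed.

Lemma gate_id B x : B \in strong_blocks g -> x \in B -> gate B x = x.
Proof. by move=> bB xB; apply: gateE; rewrite // /is_gate xB eqxx. Qed.

Lemma gate_conn B x y : B \in strong_blocks g -> x \notin B ->
  conn (~: B) x y -> gate B x = gate B y.
Proof.
move=> bB xB xy; have [<-//|nxy] := eqVneq x y.
have yB : y \notin B by case/andP: (conn_mem xy nxy); rewrite !inE.
apply: gateE => //; move: (gateP y bB); rewrite /is_gate (negPf xB) (negPf yB).
case/andP=> -> /existsP[c /and3P[cB cb yc]]; apply/existsP; exists c.
by rewrite cB cb (connect_trans xy yc).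
Qed.

Lemma conn_gate_neq B k x b : B \in strong_blocks g -> b \in B -> b != k ->
  conn (setT :\ k) x b -> gate B x != k.
Proof.
move=> bB bI bk xb; have [xB|xB] := boolP (x \in B).
  rewrite gate_id //; have [->//|nxb] := eqVneq x b.
  by case/andP: (conn_mem xb nxb); rewrite !inE andbT.
have [c [b' [cB /setIP[b'I b'k] cb' xc]]] := conn_exit xB bI xb.
rewrite (@gateE _ _ b') //; first by move: b'k; rewrite !inE andbT.
rewrite /is_gate b'I (negPf xB); apply/existsP; exists c; rewrite cB cb' /=.
by apply: connS xc; apply/subsetP => u; rewrite !inE => /andP[].
Qed.

(** All vertices on the walk from [x] to its gate in [B] share that gate, so [k], whose gate
    differs, is not on it. *)
Lemma conn_gate B k x : B \in strong_blocks g -> gate B k != gate B x ->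
  conn (setT :\ k) x (gate B x).
Proof.
move=> bB; have [xB|xB] := boolP (x \in B); first by rewrite (gate_id bB xB).
move=> nk; have := gateP x bB; rewrite {1}/is_gate (negPf xB).
case/andP=> gI /existsP[c /and3P[cB cg xc]].
have nxk: ~~ conn (~: B) x k by apply: contraNN nk => /(gate_conn bB xB)->.
have nck : c != k by apply: contraNneq nxk => <-.
have ngk : gate B x != k.
  by apply: contraNneq nk => <-; rewrite gate_id.
apply: (@connect_trans _ _ c); last by apply: conn_adj; rewrite ?in_setD1 ?nck ?ngk ?inE.
by apply: connS (conn_avoid xc nxk); apply: setSD; apply: subsetT.
Qed.

Lemma conn_block B k x y : B \in strong_blocks g -> x \in B -> y \in B ->
  x != k -> y != k -> conn (setT :\ k) x y.
Proof.
move=> bB xB yB xk yk; have /connected_onP := block_connectedD1 k bB.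
move/(_ x y); rewrite !inE xk yk => /(_ xB yB).
by apply: connS; apply: setSD; apply: subsetT.
Qed.

(** If the gate of [v] differed from both, [i] and [j] would reach their gates off [v], and [B]
    minus [v] would join these gates. *)
Lemma gate_betw B v i j : ~~ conn (setT :\ v) i j -> B \in strong_blocks g ->
  gate B v = gate B i \/ gate B v = gate B j.
Proof.
move=> nij bB; have [->|ni] := eqVneq (gate B v) (gate B i); first by left.
have [->|nj] := eqVneq (gate B v) (gate B j); first by right.
case/negP: nij; apply: (connect_trans (conn_gate bB ni)).
move: (conn_gate bB nj); rewrite conn_sym; apply: connect_trans.
have h x : gate B v != gate B x -> gate B x != v.
  by apply: contraNneq => <-; rewrite gate_id ?gate_in.
by apply: (conn_block bB); rewrite ?gate_in ?h.
Qed.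

Lemma gate_sep B k x b : B \in strong_blocks g -> k \in B -> b \in B ->
  b != k -> gate B x = k -> ~~ conn (setT :\ k) b x.
Proof.
move=> bB kB bI bk gx; apply/negP; rewrite conn_sym => xb.
by have := conn_gate_neq bB bI bk xb; rewrite gx eqxx.
Qed.

(** Take a block containing the edge by which a walk from [i] first arrives at [k]. *)
Lemma gate_toward i k : i != k ->
  exists2 B, B \in strong_blocks g & (k \in B) && (gate B i != k).
Proof.
move=> ik; have [c [b [cB]]] : exists c b, [/\ c \notin [set k],
   b \in [set k] :&: setT, adj c b & conn (setT :\: [set k]) i c].
  by apply: conn_exit (connT i k); rewrite inE.
rewrite setIT => /set1P-> ck ic.
have [B bB sB] := biconnected_sub (biconnected2 ck).
exists B => //; have /andP[cI kI]: (c \in B) && (k \in B).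
  by rewrite !(subsetP sB) ?inE ?eqxx ?orbT.
rewrite kI; apply: (conn_gate_neq bB cI) => //.
by rewrite inE in cB.
Qed.

(** The gates of [i] in [A] and [B] are joined off [k] through [i], so the gate in [A] of [gate B i]
    is not [k]. But distinct blocks share at most the vertex [k], so a walk inside [B] from
    [gate B i] to [k] enters [A] only at [k]. *)
Lemma gate_toward_uniq A B i k : A \in strong_blocks g ->
  B \in strong_blocks g -> k \in A -> k \in B ->
  gate A i != k -> gate B i != k -> A = B.
Proof.
move=> bA bB kA kB gA gB; have [//|nAB] := eqVneq A B.
have cAB : conn (setT :\ k) (gate A i) (gate B i).
  have h C : C \in strong_blocks g -> k \in C -> gate C i != k ->
      conn (setT :\ k) i (gate C i).
    by move=> bC kC; rewrite eq_sym -{1}(gate_id bC kC); apply: conn_gate.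
  by have := h A bA kA gA; rewrite conn_sym => /connect_trans; apply; apply: h.
have bInA : gate B i \notin A.
  apply: contraNN nAB => gBA; apply/eqP.
  by apply: (block_eq bA bB gBA _ kA kB gB); rewrite gate_in.
have gBk : gate A (gate B i) != k.
  apply: (conn_gate_neq bA (gate_in i bA) gA).
  by rewrite conn_sym.
have /connected_onP cB := block_connected bB.
have [c [b [cA /setIP[bA' bB'] cb gc]]] :=
  conn_exit bInA kA (cB _ _ (gate_in i bB) kB).
have bk : b = k.
  by apply/eqP; apply: contraNT nAB => bk; apply/eqP;
     apply: block_eq bA bB bA' bB' kA kB bk.
case/eqP: gBk; apply: gateE; rewrite // /is_gate kA (negPf bInA) -bk.
apply/existsP; exists c; rewrite cA cb; apply: connS gc.
by apply/subsetP => u; rewrite !inE => /andP[].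
Qed.

(** If [u] in [B] has gate [k] other than [u], a vertex of [B] with another gate would give a walk
    from [u] into [A] off [k]. Otherwise both vertices lie in [A] and [B], hence coincide. *)
Lemma gate_const A B x y : A \in strong_blocks g -> B \in strong_blocks g ->
  A != B -> x \in B -> y \in B -> gate A x = gate A y.
Proof.
move=> bA bB nAB.
have key u v : u \in B -> v \in B -> u != gate A u -> gate A u = gate A v.
  set k := gate A u => uB vB uk; apply/eqP; apply: contraT => kv.
  have kA : k \in A by apply: gate_in.
  have vk : v != k by apply: contraNneq kv => ->; rewrite gate_id.
  have /eqP[] // : gate A u != k.
  apply: (conn_gate_neq bA (gate_in v bA)); rewrite 1?eq_sym //.
  apply: connect_trans (conn_block bB uB vB uk vk) _.
  by apply: conn_gate; rewrite // gate_id.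
move=> xB yB; have [ex|nx] := eqVneq x (gate A x); last exact: key.
have [ey|ny] := eqVneq y (gate A y); last by apply/esym/key.
have [->//|nxy] := eqVneq x y; case/eqP: nAB.
have [xA yA] : x \in A /\ y \in A by rewrite ex ey !gate_in.
exact: block_eq bA bB xA xB yA yB nxy.
Qed.

(** * Separating vertices and the measure of the distance recursions *)

Lemma separates_conn v i j : separates g v i j -> ~~ conn (setT :\ v) i j.
Proof. by case/and4P. Qed.

Lemma conn_separates v i j : v != i -> v != j -> ~~ conn (setT :\ v) i j ->
  separates g v i j.
Proof.
move=> vi vj nij; rewrite /separates vi vj nij andbT /cut_vertex inE /=.
apply/andP; split; first by apply/connected_onP => x y _ _; apply: connT.
apply: contraNN nij => /connected_onP; apply.
  by rewrite !inE eq_sym vi.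
by rewrite !inE eq_sym vj.
Qed.

Lemma separates_exists i j : i != j ->
  (forall B, B \in strong_blocks g -> ~~ ((i \in B) && (j \in B))) ->
  exists v, separates g v i j.
Proof.
move=> ij nB; have [B bB /andP[jB gj]] := gate_toward ij.
exists (gate B i); apply: conn_separates => //.
  by apply: contraNneq (nB B bB) => <-; rewrite gate_in.
rewrite conn_sym; apply: (gate_sep bB) => //; first exact: gate_in.
by rewrite eq_sym.
Qed.

(** These are the blocks crossed on the way from [i] to [j]; their number decreases along the
    distance recursions. *)
Definition diff_blocks i j := [set B in strong_blocks g | gate B i != gate B j].

Definition ndiff i j := #|diff_blocks i j|.

Lemma diff_blocksE i j B : (B \in diff_blocks i j)
  = (B \in strong_blocks g) && (gate B i != gate B j).
Proof. by rewrite in_set. Qed.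

Lemma ndiffC i j : ndiff i j = ndiff j i.
Proof. by apply: eq_card => B; rewrite !diff_blocksE eq_sym. Qed.

Lemma ndiff_gt0 i j : i != j -> 0 < ndiff i j.
Proof.
move=> /gate_toward[B bB /andP[jB gi]]; apply/card_gt0P; exists B.
by rewrite diff_blocksE bB (gate_id bB jB).
Qed.

(** By [gate_betw], a block telling [i] from [v] also tells [i] from [j]. The block at [j] facing
    [v] makes the inclusion strict: there [v] has the gate of [i]. *)
Lemma ndiff_lt v i j : v != j -> ~~ conn (setT :\ v) i j ->
  ndiff i v < ndiff i j.
Proof.
move=> /gate_toward[B bB /andP[jB gv]] nij; apply/proper_card/properP; split.
  apply/subsetP => A; rewrite !diff_blocksE => /andP[bA]; rewrite bA /=.
  by case: (gate_betw nij bA) => ->; rewrite ?eqxx.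
have gv' : gate B v != gate B j by rewrite (gate_id bB jB).
case: (gate_betw nij bB) => e; last by rewrite e eqxx in gv'.
by exists B; rewrite !diff_blocksE bB -e ?gv' ?eqxx.
Qed.

(** Sending a block to the gate of [i] is injective here, since only one block at that gate faces
    [j]. *)
Lemma ndiff_max i j : ndiff i j <= #|V|.
Proof.
rewrite /ndiff -(@card_in_imset _ _ (gate^~ i)) ?max_card // => A B.
rewrite !diff_blocksE => /andP[bA gA] /andP[bB gB] eAB.
apply: (@gate_toward_uniq A B j (gate A i)) => //; rewrite ?gate_in //.
- by rewrite eAB gate_in.
- by rewrite eq_sym.
by rewrite eAB eq_sym.
Qed.

(** The right-hand side is itself admissible. Conversely, in an admissible set every vertex other
    than [i] reaches [A] off [i], so its gate is not [i]; maximal cardinality then forces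
    equality. *)
Lemma branchE A i : A \in strong_blocks g -> i \in A ->
  branch g i A = i |: [set j | gate A j != i].
Proof.
move=> bA iA; set T := _ |: _; rewrite /branch; case: arg_maxnP => [|S].
  rewrite subxx block_connected //= /cut_vertex iA block_connected //=.
  by rewrite negbK block_connectedD1.
case/and3P=> sAS cS niS maxS.
have cSi : connected_on g (S :\ i).
  by move: niS; rewrite /cut_vertex (subsetP sAS) ?cS // negbK.
have cA := block_connected bA.
have sAT : A \subset T.
  apply/subsetP => b bI; rewrite !inE (gate_id bA bI).
  by case: (b == i).
have cTi : connected_on g (T :\ i).
  apply: connected_on_via (setSD _ sAT) (block_connectedD1 _ bA) _ => x.
  rewrite !inE => /andP[xi]; rewrite (negPf xi) => /= gx.
  exists (gate A x); first by rewrite !inE gx gate_in.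
  have [xA|xA] := boolP (x \in A); first by rewrite (gate_id bA xA) connect0.
  have := gateP x bA; rewrite {1}/is_gate (negPf xA) gate_in //=.
  case/existsP => c /and3P[cA' cg xc].
  (* Along a walk outside [A] the gate is constant, so the walk stays in [T :\ i]. *)
  have xcT : conn (T :\ i) x c.
    case/connectP: xc => p; elim: p x {xi xA cg} gx => [|z p IH] x gx /=.
      by move=> _ ->; apply: connect0.
    case/andP=> xz zp ec; have [xA zA] : x \notin A /\ z \notin A.
      by case/and3P: xz; rewrite !inE.
    have gz : gate A z != i.
      by rewrite -(gate_conn bA xA) //; apply: connect1.
    apply: connect_trans (IH z gz zp ec).
    apply: conn_adj; last by case/and3P: xz.
      by rewrite !inE gx orbT andbT; apply: contraNneq xA => ->.
    by rewrite !inE gz orbT andbT; apply: contraNneq zA => ->.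
  apply: connect_trans xcT _; apply: conn_adj => //; rewrite !inE.
    rewrite -(gate_conn bA xA xc) gx orbT andbT.
    by apply: contraNneq cA' => ->.
  by rewrite gx (gate_id bA (gate_in x bA)) gx orbT.
have cT : connected_on g T.
  apply: connected_on_via sAT cA _ => x; rewrite in_setU1 => /predU1P[->|xT].
    by exists i; rewrite ?connect0.
  rewrite inE in xT; exists (gate A x); first exact: gate_in.
  have [->|xi] := eqVneq x i; first by rewrite gate_id ?connect0.
  have /connected_onP := cTi; move/(_ x (gate A x)); rewrite !inE xi xT orbT.
  rewrite (gate_id bA (gate_in x bA)) xT orbT => /(_ isT isT).
  by apply: connS; apply: subsetDl.
apply/eqP; rewrite eqEcard; apply/andP; split; last first.
  by apply: maxS; rewrite sAT cT /cut_vertex cTi /= !andbF.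
apply/subsetP => x xS; rewrite !inE; have [//|xi /=] := eqVneq x i.
have [B bB /andP[iB gx]] := gate_toward xi.
(* If [A] were just [i], it would be properly contained in the block [B] at [i], against
   maximality. *)
have [b bI bi] : exists2 b, b \in A & b != i.
  have [AB|nAB] := eqVneq A B; first by exists (gate B x); rewrite ?AB ?gate_in.
  have [//|no] := boolP [exists b in A, b != i].
    by move=> /exists_inP[b bI bi]; exists b.
  case/eqP: nAB; apply/esym; apply: (block_max bA (block_biconnected bB)).
  apply/subsetP => b bI; suff -> : b = i by [].
  apply/eqP; apply: contraNT no => bi; by apply/exists_inP; exists b.
apply: (conn_gate_neq bA bI bi).
have /connected_onP/(_ x b) := cSi; rewrite !in_setD1 xi bi xS (subsetP sAS) //.
by move/(_ isT isT); apply: connS; apply: setSD; apply: subsetT.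
Qed.

(** All of [B] has one gate in [A]. If that gate is [i], the branch meets [B] in at most [i], and
    [B] inside the branch would force [B] inside [A]. *)
Lemma sub_branch A B i b : A \in strong_blocks g -> B \in strong_blocks g ->
  A != B -> i \in A -> b \in B -> (B \subset branch g i A) = (gate A b != i).
Proof.
move=> bA bB nAB iA bI; rewrite branchE //; have [gb|gb] := eqVneq _ i.
  apply: contraNF (nAB) => /subsetP sB; rewrite eq_sym; apply/eqP/esym.
  apply: (block_max bB (block_biconnected bA)); apply/subsetP => x /[dup] xB.
  by move/sB; rewrite !inE (gate_const bA bB nAB xB bI) gb eqxx orbF => /eqP->.
apply/subsetP => x xB.
by rewrite !inE (gate_const bA bB nAB xB bI) gb orbT.
Qed.

Lemma block_gt1 (B : {set V}) (i j : V) : B \in strong_blocks g -> i != j -> 1 < #|B|.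
Proof.
move=> bB ij; have /set0Pn[x xB] := block_neq0 bB.
have [y yx] : exists y, y != x.
  have [e|] := eqVneq i x; last by exists i.
  by exists j; rewrite -e eq_sym.
have [A bA /andP[xA gy]] := gate_toward yx.
rewrite (cardsD1 x) xB ltnS; apply/card_gt0P.
have [e|nAB] := eqVneq A B.
  by exists (gate B y); rewrite in_setD1 gate_in ?andbT -?e.

apply/existsP; apply: contraNT nAB; rewrite negb_exists => /forallP no.
apply/eqP; apply: (block_max bB (block_biconnected bA)).
apply/subsetP => z zB; have := no z; rewrite !inE zB andbT negbK => /eqP->//.
Qed.

End Gates.

(** * Determinants *)

(** A permutation other than the identity with no zero factor would give [h (s i)] a larger sum than
    [h i], yet [s] only reorders the summands. *)
Lemma det_rank_triangular (R : comNzRingType) n (h : 'I_n -> nat) (A : 'M[R]_n) :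
  (forall i j, A i j != 0 -> i != j -> (h i < h j)%N) ->
  \det A = \prod_i A i i.
Proof.
move=> tri; rewrite /determinant (bigD1 (1%g : 'S_n)) //= odd_perm1 expr0 mul1r.
rewrite [X in _ + X]big1 ?addr0 => [|s s1].
  by apply: eq_bigr => i _; rewrite perm1.
have [/existsP[i /eqP Ai0]|no] := boolP [exists i, A i (s i) == 0].
  by rewrite (bigD1 i) //= Ai0 mul0r mulr0.
have le i : (h i <= h (s i))%N.
  have [<-//|ni] := eqVneq i (s i); apply/ltnW/tri => //.
  by apply: contraNneq no => e; apply/existsP; exists i; rewrite e.
have [i si] : exists i, s i != i.
  apply/existsP; apply: contraNT s1; rewrite negb_exists => /forallP fix_s.
  by apply/eqP/permP => i; rewrite perm1; apply/eqP; rewrite -[_ == _]negbK.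
have : (\sum_i h i < \sum_i h (s i))%N.
  rewrite [ltnLHS](bigD1 i) // [ltnRHS](bigD1 i) //= -addSn leq_add ?leq_sum //.
  apply: tri; last by rewrite eq_sym.
  by apply: contraNneq no => e; apply/existsP; exists i; rewrite e.
by rewrite -(reindex_inj (@perm_inj _ s) (P := xpredT) (F := h)) ltnn.
Qed.

(** Sylvester's determinant identity: two block factorisations of the matrix with identity diagonal
    blocks and off-diagonal blocks [u], [v]. *)
Lemma det_1sub_mulmx (R : comNzRingType) m n (u : 'M[R]_(m, n)) (v : 'M[R]_(n, m)) :
  \det (1%:M - u *m v) = \det (1%:M - v *m u).
Proof.
have e : block_mx 1%:M u 0 1%:M *m block_mx (1%:M - u *m v) 0 v 1%:M
    = block_mx 1%:M 0 v 1%:M *m block_mx 1%:M u 0 (1%:M - v *m u).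
  rewrite !mulmx_block !mul1mx !mulmx1 ?mul0mx ?mulmx0 ?add0r !addr0.
  by rewrite subrK addrCA subrr !addr0.
have := congr1 (@determinant _ _) e; rewrite !det_mulmx.
by rewrite !det_ublock !det_lblock !det1 !mul1r !mulr1.
Qed.

(** * The distance matrices *)

Section Inverse.

Variables (R : comUnitRingType) (n : nat) (g : rel 'I_n).
Variables (a : {set 'I_n} -> R) (Ms : {set 'I_n} -> 'M[R]_n).
Hypotheses (g_strong : strongly_connected g) (Ms_diag : unit_diagonals g Ms).

Local Notation gate := (gate g).
Local Notation blocks := (strong_blocks g).
Local Notation conn S := (connect (undirected_on g S)).

(** * Closed forms of the two distance matrices *)

Definition mdist i j : R := \prod_(B in blocks) Ms B (gate B i) (gate B j).

Definition adist i j : R :=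
  \sum_(B in blocks) mdist i (gate B i) * (a B * (Ms B (gate B i) (gate B j) - 1)).

Lemma Ms_gate B i : B \in blocks -> Ms B (gate B i) (gate B i) = 1.
Proof. by move=> bB; rewrite Ms_diag ?gate_in. Qed.

Lemma mdist_id i : mdist i i = 1.
Proof. by apply: big1 => B; apply: Ms_gate. Qed.

Lemma mdist_block B i j : B \in blocks -> i \in B -> j \in B ->
  mdist i j = Ms B i j.
Proof.
move=> bB iB jB; rewrite /mdist (bigD1 B) //= !gate_id // big1 ?mulr1 //.
by move=> A /andP[bA nAB]; rewrite (gate_const _ bA bB nAB iB jB) // Ms_gate.
Qed.

(** Betweenness is expressed by gates rather than by separation, so that [v] may equal [i] or
    [j]. *)
Lemma mdist_betw v i j :
  (forall B, B \in blocks -> gate B v = gate B i \/ gate B v = gate B j) ->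
  mdist i j = mdist i v * mdist v j.
Proof.
move=> betw; rewrite -big_split; apply: eq_bigr => B bB /=.
by case: (betw B bB) => ->; rewrite Ms_gate // ?mul1r ?mulr1.
Qed.

Lemma betw_gate B i j : B \in blocks -> i \in B -> forall A, A \in blocks ->
  gate A (gate B j) = gate A i \/ gate A (gate B j) = gate A j.
Proof.
move=> bB iB A bA; have [->|nj] := eqVneq (gate B j) i; first by left.
apply: gate_betw bA => //; apply: (gate_sep g_strong bB) => //.
  exact: gate_in.
by rewrite eq_sym.
Qed.

Lemma mdist_gatel B i j : B \in blocks -> i \in B ->
  mdist i j = Ms B i (gate B j) * mdist (gate B j) j.
Proof.
move=> bB iB; rewrite -(mdist_block bB iB) ?gate_in //.
by apply: mdist_betw; apply: betw_gate.
Qed.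

Lemma mdist_gater B i j : B \in blocks -> j \in B ->
  mdist i j = mdist i (gate B i) * Ms B (gate B i) j.
Proof.
move=> bB jB; rewrite -(mdist_block bB _ jB) ?gate_in //.
apply: mdist_betw => A bA.
by case: (betw_gate i bB jB bA) => ->; [right | left].
Qed.

Lemma adist_block B i j : B \in blocks -> i \in B -> j \in B ->
  adist i j = a B * (Ms B i j - 1).
Proof.
move=> bB iB jB; rewrite /adist (bigD1 B) //= !gate_id // mdist_id mul1r.
rewrite big1 ?addr0 // => A /andP[bA nAB].
by rewrite (gate_const _ bA bB nAB iB jB) // Ms_gate // subrr !mulr0.
Qed.

Lemma adist_betw v i j : ~~ conn (setT :\ v) i j ->
  adist i j = adist i v + mdist i v * adist v j.
Proof.
move=> nij; rewrite mulr_sumr -big_split; apply: eq_bigr => B bB /=.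
case: (gate_betw g_strong nij bB) => e; last first.
  by rewrite e Ms_gate // subrr !mulr0 addr0.
rewrite e Ms_gate // subrr !mulr0 add0r [RHS]mulrA.
have [->|gij] := eqVneq (gate B i) (gate B j).
  by rewrite Ms_gate // subrr !mulr0.
(* Here [v] is its own gate in [B] or separates [i] from that gate: otherwise [i] would reach [j]
   off [v] through [B]. *)
rewrite -e; congr (_ * _); have [ev|nv] := eqVneq v (gate B v).
  by rewrite -ev mdist_id mulr1.
apply: mdist_betw => A; apply: gate_betw => //.
apply: contraNN nij => iv; apply: (connect_trans iv).
have gvj : gate B v != gate B j by rewrite e.
apply: (@connect_trans _ _ (gate B j)); last first.
  by rewrite conn_sym; apply: conn_gate.
apply: (conn_block bB); rewrite ?gate_in // 1?eq_sym //.
by apply: contraNneq gvj => ->; rewrite gate_id ?gate_in.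
Qed.

Lemma common_blockP i j : if common_block g i j is Some B
  then [/\ B \in blocks, i \in B & j \in B]
  else i != j /\ exists v, separates g v i j.
Proof.
rewrite /common_block; case: pickP => [B /andP[bB /andP[iB jB]] //|no].
have ij : i != j.
  apply/eqP => e; have [B bB iB] := block_exists g i.
  by have := no B; rewrite bB -e iB.
split=> //; apply: separates_exists => // B bB; apply/negP => ijB.
by have := no B; rewrite bB ijB.
Qed.

Lemma ndiff_sep v i j : separates g v i j ->
  (0 < ndiff g i v < ndiff g i j)%N /\ (0 < ndiff g v j < ndiff g i j)%N.
Proof.
move=> sv; have nij := separates_conn sv; case/and4P: sv => vi vj _ _.
rewrite !ndiff_gt0 // 1?eq_sym // !ndiff_lt //=; split=> //.
by rewrite ndiffC [ndiff g i j]ndiffC ndiff_lt // conn_sym.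
Qed.

(** The bound is [k.+1] because pairs in a common block are answered without fuel; any other pair
    has [ndiff] at least 2. *)
Lemma mult_dist_recE k i j : (ndiff g i j <= k.+1)%N ->
  mult_dist_rec g Ms k i j = mdist i j.
Proof.
elim: k i j => [|k IH] i j le_k; rewrite /=; have := common_blockP i j;
  case: common_block => [B [bB iB jB]|[ij [v0 v0P]]]; try exact/esym/mdist_block.
  case: (ndiff_sep v0P) => /andP[lt0 lt1] _.
  by have := leq_trans (leq_ltn_trans lt0 lt1) le_k.
case: pickP => [v vP|/(_ v0)]; last by rewrite v0P.
case: (ndiff_sep vP) => /andP[_ lt1] /andP[_ lt2].
have [le1 le2] := (leq_trans lt1 le_k, leq_trans lt2 le_k).
rewrite !IH //.
by apply/esym/mdist_betw => B; apply: gate_betw (separates_conn vP).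
Qed.

Lemma mult_dist_mxE i j : mult_dist_mx g Ms i j = mdist i j.
Proof.
rewrite mxE mult_dist_recE // (leq_trans (ndiff_max _ _ _)) //.
by rewrite card_ord.
Qed.

Lemma addmult_dist_recE k i j : (ndiff g i j <= k.+1)%N ->
  addmult_dist_rec g a Ms k i j = adist i j.
Proof.
elim: k i j => [|k IH] i j le_k; rewrite /=; have := common_blockP i j;
  case: common_block => [B [bB iB jB]|[ij [v0 v0P]]]; try exact/esym/adist_block.
  case: (ndiff_sep v0P) => /andP[lt0 lt1] _.
  by have := leq_trans (leq_ltn_trans lt0 lt1) le_k.
case: pickP => [v vP|/(_ v0)]; last by rewrite v0P.
case: (ndiff_sep vP) => /andP[_ lt1] /andP[_ lt2].
have [le1 le2] := (leq_trans lt1 le_k, leq_trans lt2 le_k).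
rewrite !IH // mult_dist_mxE.
exact/esym/adist_betw/separates_conn.
Qed.

Lemma addmult_dist_mxE i j : addmult_dist_mx g a Ms i j = adist i j.
Proof.
rewrite mxE addmult_dist_recE // (leq_trans (ndiff_max _ _ _)) //.
by rewrite card_ord.
Qed.

(** * The all-ones system on the graph and on its blocks *)

Hypothesis Ms_unit : mult_dist_mx g Ms \in unitmx.

Lemma exchange_blocks (f : {set 'I_n} -> 'I_n -> R) :
  \sum_j \sum_(B in blocks | j \in B) f B j
  = \sum_(B in blocks) \sum_(j in B) f B j.
Proof.
rewrite (exchange_big_dep (mem blocks)) /= => [|j B _ /andP[]//].
by apply: eq_bigr => B bB; apply: eq_bigl => j; rewrite bB.
Qed.

Lemma sum_toward i k (f : {set 'I_n} -> R) B : B \in blocks -> k \in B ->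
  gate B i != k -> \sum_(A in blocks | k \in A) (gate A i != k)%:R * f A = f B.
Proof.
move=> bB kB gi; rewrite (bigD1 B) ?bB //= gi mul1r big1 ?addr0 //.
move=> A /andP[/andP[bA kA] nAB]; have [_|gA] := eqVneq; first by rewrite mul0r.
case/eqP: nAB; exact: (gate_toward_uniq g_strong) bA bB kA kB gA gi.
Qed.

Lemma count_toward i k :
  \sum_(B in blocks | k \in B) (gate B i != k)%:R = (i != k)%:R :> R.
Proof.
have [->|ik] := eqVneq i k.
  by apply: big1 => B /andP[bB kB]; rewrite gate_id ?eqxx.
have [B bB /andP[kB gi]] := gate_toward g_strong ik.
rewrite -[RHS](sum_toward (fun=> 1) bB kB gi).
by apply: eq_bigr => A _; rewrite mulr1.
Qed.

Lemma sum_gate_delta B k (f : 'I_n -> R) : B \in blocks ->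
  \sum_(j in B) f j * (gate B k == j)%:R = f (gate B k).
Proof.
move=> bB; rewrite (bigD1 (gate B k)) ?gate_in //= eqxx mulr1 big1 ?addr0 //.
by move=> j /andP[_ /negPf]; rewrite eq_sym => ->; rewrite mulr0.
Qed.

Lemma sum_gate_fiber B i (u : 'I_n -> R) : B \in blocks -> i \in B ->
  \sum_(b in B) Ms B i b * (\sum_(j | gate B j == b) mdist b j * u j)
  = \sum_j mdist i j * u j.
Proof.
move=> bB iB; rewrite [RHS](partition_big (gate B) (mem B)) => /= [|j _];
  last exact: gate_in.
apply: eq_bigr => b bI; rewrite mulr_sumr; apply: eq_bigr => j /eqP gj.
by rewrite mulrA (mdist_gatel j bB iB) gj.
Qed.

(** A right inverse comes from the inverse of the whole matrix by folding all rows behind a gate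
    [b], with weights [mdist b j], into row [b]. *)
Lemma block_mult_unit B : B \in blocks -> block_mult_mx Ms B \in unitmx.
Proof.
move=> bB; pose X : 'M_#|B| := \matrix_(p, q) \sum_(j | gate B j == enum_val p)
  mdist (enum_val p) j * invmx (mult_dist_mx g Ms) j (enum_val q).
suff /mulmx1_unit[] : block_mult_mx Ms B *m X = 1%:M by [].
apply/matrixP => p q; have /= pB := enum_valP p.
pose u j := invmx (mult_dist_mx g Ms) j (enum_val q).
transitivity ((mult_dist_mx g Ms *m invmx (mult_dist_mx g Ms))
  (enum_val p) (enum_val q)); last first.
  by rewrite mulmxV // !mxE (inj_eq enum_val_inj).
rewrite !mxE; under [RHS]eq_bigr do rewrite mult_dist_mxE.
rewrite -(sum_gate_fiber u bB pB) [RHS]big_enum_val; apply: eq_bigr => r _.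
by rewrite !mxE.
Qed.

Local Notation t i := (tau_out g Ms i 0).

(* [block_tau B] is the solution on [B] of [Ms B *m block_tau B = 1]. *)
Definition block_tau B b : R := \sum_(j | gate B j == b) mdist b j * t j.

Definition block_excess B : R := a B * (1 - \sum_(b in B) block_tau B b).

Definition excess : R := \sum_(B in blocks) block_excess B.

(** The factor up to the gate splits off; the rest regroups by gates into a row of
    [mult_dist_mx *m tau_out], which is 1. *)
Lemma sum_block_tau B i : B \in blocks ->
  \sum_(b in B) mdist i b * block_tau B b = mdist i (gate B i).
Proof.
move=> bB; under eq_bigr => b bI do rewrite (mdist_gater i bB bI) -mulrA.
rewrite -mulr_sumr sum_gate_fiber ?gate_in //.
transitivity (mdist i (gate B i) * (mult_dist_mx g Ms *m tau_out g Ms) (gate B i) 0).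
  congr (_ * _); rewrite mxE; apply: eq_bigr => j _.
  by rewrite mult_dist_mxE.
by rewrite /tau_out mulmxA mulmxV // mul1mx mxE mulr1.
Qed.

(** Exactly one block at [j] faces a vertex [i] other than [j]. Based at [i], each block's terms
    cancel when weighted by row [i] of the distance matrix. *)
Lemma sum_block_tau_rebase i j :
  1 + \sum_(B in blocks | j \in B) (block_tau B j - 1)
  = (i == j)%:R + \sum_(B in blocks | j \in B) (block_tau B j - (gate B i == j)%:R).
Proof.
apply/eqP; rewrite eq_sym -subr_eq0 opprD addrACA -sumrB.
rewrite (eq_bigr (fun B => (gate B i != j)%:R)) ?count_toward.
  by case: (i == j); rewrite /= ?subrr add0r ?addNr.
move=> B _; rewrite opprD opprK addrACA subrr add0r addrC.
by case: (_ == j); rewrite /= ?subrr ?subr0.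
Qed.

Lemma tau_outE i : t i = 1 + \sum_(B in blocks | i \in B) (block_tau B i - 1).
Proof.
pose z : 'cV[R]_n := \col_j (1 + \sum_(B in blocks | j \in B) (block_tau B j - 1)).
suff Mz : mult_dist_mx g Ms *m z = const_mx 1.
  by rewrite /tau_out -Mz mulKmx // mxE.
apply/matrixP => k l; rewrite mxE [RHS]mxE.
under eq_bigr => j _ do
  rewrite mult_dist_mxE mxE (sum_block_tau_rebase k) mulrDr mulr_sumr.
rewrite big_split /= exchange_blocks (bigD1 k) //= eqxx mulr1 mdist_id.
rewrite big1 => [|j /negPf]; last by rewrite eq_sym => ->; rewrite mulr0.
rewrite big1 ?addr0 // => B bB.
under eq_bigr do rewrite mulrBr.
by rewrite sumrB sum_block_tau // sum_gate_delta // subrr.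
Qed.

(** With [u] the block solution, the additive block is [a B] times [block_mult_mx Ms B] times a
    rank-one perturbation of the identity, whose determinant is a scalar by [det_1sub_mulmx]. *)
Lemma block_excessE B : B \in blocks -> a B \is a GRing.unit ->
  \det (block_addmult_mx a Ms B) / block_kappa a Ms B = block_excess B.
Proof.
move=> bB aU; have MU := block_mult_unit bB.
pose u : 'cV[R]_#|B| := \col_p block_tau B (enum_val p).
have Mu : block_mult_mx Ms B *m u = const_mx 1.
  apply/matrixP => p q; have /= pB := enum_valP p.
  have := sum_block_tau (enum_val p) bB.
  rewrite gate_id // mdist_id big_enum_val => sum1; rewrite mxE [RHS]mxE -sum1.
  apply: eq_bigr => r _.
  by rewrite !mxE (mdist_block bB) ?enum_valP.
have -> : block_addmult_mx a Ms B
    = a B *: (block_mult_mx Ms B *m (1%:M - u *m (const_mx 1 : 'rV_#|B|))).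
  rewrite /block_addmult_mx mulmxBr mulmx1 mulmxA Mu; congr (_ *: (_ - _)).
  by apply/matrixP => p q; rewrite !mxE big_ord1 !mxE mulr1.
rewrite detZ det_mulmx det_1sub_mulmx det_mx11 !mxE eqxx.
have -> : \sum_j (const_mx 1 : 'rV_#|B|) 0 j * u j 0 = \sum_(b in B) block_tau B b.
  by rewrite [RHS]big_enum_val; apply: eq_bigr => p _; rewrite !mxE mul1r.
have B0 : (0 < #|B|)%N by rewrite card_gt0 (block_neq0 bB).
rewrite /block_kappa /block_excess -{1}(subnK B0) addn1 exprS subn1.
have KU : a B ^+ #|B|.-1 * \det (block_mult_mx Ms B) \is a GRing.unit.
  by rewrite unitrM unitrX // -unitmxE.
by rewrite [\det _ * _]mulrC mulrACA mulrK.
Qed.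

(** * The factor [gate_mx] and its determinant *)

Definition gate_mx : 'M[R]_n := \matrix_(j, k)
  \sum_(B in blocks | j \in B) a B * ((gate B k == j)%:R - block_tau B j).

Lemma addmult_dist_mx_factor : addmult_dist_mx g a Ms = mult_dist_mx g Ms *m gate_mx.
Proof.
apply/matrixP => i k; rewrite addmult_dist_mxE mxE.
under [RHS]eq_bigr => j _ do rewrite mult_dist_mxE mxE mulr_sumr.
rewrite exchange_blocks; apply: eq_bigr => B bB.
under eq_bigr do rewrite mulrCA.
rewrite -mulr_sumr mulrCA; congr (_ * _).
under eq_bigr do rewrite mulrBr.
rewrite sumrB sum_block_tau // sum_gate_delta // mulrBr mulr1.
by rewrite (mdist_gater i bB (gate_in g_strong k bB)).
Qed.

Lemma gate_mx_colsum k : \sum_j gate_mx j k = excess.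
Proof.
under eq_bigr do rewrite mxE.
rewrite exchange_blocks; apply: eq_bigr => B bB.
rewrite -mulr_sumr sumrB; congr (_ * (_ - _)).
rewrite -[RHS](sum_gate_delta k (fun=> 1) bB).
by apply: eq_bigr => j _; rewrite mul1r.
Qed.

Lemma gate_mx_sub j k r : gate_mx j k - gate_mx j r
  = \sum_(B in blocks | j \in B) a B * ((gate B k == j)%:R - (gate B r == j)%:R).
Proof.
rewrite !mxE -sumrB; apply: eq_bigr => B _.
by rewrite -mulrBr opprB addrA subrK.
Qed.

(** Only one block at [j] faces [r], so the product has a single factor; this form lets the
    determinant be regrouped by blocks. *)
Lemma gate_mx_sub_diag j r : j != r ->
  gate_mx j j - gate_mx j r = \prod_(B in blocks | (j \in B) && (gate B r != j)) a B.
Proof.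
move=> jr; rewrite gate_mx_sub.
have [|B bB /andP[jB gr]] := @gate_toward _ g g_strong r j.
  by rewrite eq_sym.
rewrite [RHS](big_pred1 B) => [|A]; last first.
  apply/idP/eqP => [/andP[bA /andP[jA gA]]|->]; last by rewrite bB jB gr.
  exact: (gate_toward_uniq g_strong) bA bB jA jB gA gr.
rewrite -(sum_toward a bB jB gr); apply: eq_bigr => A /andP[bA jA].
by rewrite gate_id // eqxx mulrC; case: (_ == j); rewrite /= ?subrr ?subr0.
Qed.

(* Row [r] of [gate_mx] is replaced by the sum of all rows, and column [r] is
   subtracted from the others; what remains is triangular for the order
   "[j] separates [r] from [k]". *)
Lemma det_gate_mx (r : 'I_n) :
  \det gate_mx = excess * \prod_(B in blocks) a B ^+ (#|B| - 1).
Proof.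
(* One matrix [P] does both operations: on the left it adds all rows into row [r], and its inverse
   on the right subtracts column [r]. *)
pose P : 'M[R]_n := \matrix_(j, k) ((j == k) || (j == r))%:R.
pose X : 'M[R]_n := \matrix_(j, k)
  if j == r then excess * (k == r)%:R
  else if k == r then gate_mx j r else gate_mx j k - gate_mx j r.
have PgP : P *m gate_mx = X *m P.
  apply/matrixP => j k; rewrite [LHS]mxE [RHS]mxE.
  have -> : \sum_l X j l * P l k = (k != r)%:R * X j r + X j k.
    have [kr|kr] := eqVneq k r.
      rewrite mul0r add0r (bigD1 k) //= big1 => [|l lk].
        by rewrite [P _ _]mxE eqxx mulr1 addr0.
      by rewrite [P _ _]mxE -kr (negPf lk) mulr0.
    rewrite (bigD1 r) //= (bigD1 k) //= big1 => [|l /andP[lr lk]].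
      by rewrite ![P _ _]mxE !eqxx orbT !mulr1 mul1r addr0.
    by rewrite [P _ _]mxE (negPf lr) (negPf lk) mulr0.
  have [jr|jr] := eqVneq j r.
    rewrite (eq_bigr (gate_mx^~ k)) ?gate_mx_colsum => [|l _].
      rewrite !mxE jr !eqxx; case: (k == r); rewrite /= ?mul0r ?add0r ?mulr1 //.
      by rewrite mulr0 addr0 mul1r.
    by rewrite mxE jr eqxx orbT mul1r.
  rewrite (bigD1 j) //= big1 => [|l lj]; last first.
    by rewrite mxE eq_sym (negPf lj) (negPf jr) mul0r.
  rewrite [P _ _]mxE eqxx mul1r addr0 [X j r]mxE [X j k]mxE (negPf jr) eqxx.
  have [->|kr] := eqVneq k r; first by rewrite mul0r add0r.
  by rewrite mul1r addrC subrK.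
have detP : \det P = 1.
  rewrite (det_rank_triangular (h := fun j => (j != r) : nat)) => [|j k].
    by apply: big1 => j _; rewrite mxE eqxx.
  rewrite mxE => + jk; rewrite (negPf jk) /=; have [jr _|] := eqVneq j r.
    by rewrite -jr eq_sym jk.
  by rewrite eqxx.
have := congr1 (@determinant _ _) PgP; rewrite !det_mulmx detP mul1r mulr1 => ->.
(* Column [r] may be full, so [r] is ranked above every value of [ndiff g r]. *)
rewrite (det_rank_triangular (h := fun j =>
  if j == r then #|strong_blocks g|.+1 else ndiff g r j)) => [|j k].
  rewrite (bigD1 r) //= mxE eqxx mulr1; congr (_ * _).
  under eq_bigr => j jr do rewrite mxE (negPf jr) gate_mx_sub_diag //.
  rewrite (exchange_big_dep (mem blocks)) /= => [|j B _ /andP[]//].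
  (* Each [j] in [B] except the gate of [r] contributes one factor [a B]. *)
  apply: eq_bigr => B bB; rewrite prodr_const; congr (_ ^+ _).
  rewrite (cardsD1 (gate B r) B) gate_in // add1n subn1 /=.
  apply: eq_card => j; rewrite in_setD1.
  rewrite [LHS](_ : _ = [&& j != r, B \in blocks, j \in B & gate B r != j]) // bB.
  have [->|jr] /= := eqVneq j r; last by rewrite andbC eq_sym.
  by apply/esym/negP => /andP[/eqP ne rB]; apply: ne; rewrite gate_id.
rewrite mxE; have [->|jr] := eqVneq j r.
  by move=> + rk; rewrite [k == r]eq_sym (negPf rk) mulr0 eqxx.
have [kr _ _|kr] := eqVneq k r; first by rewrite ltnS subset_leq_card //;
  apply/subsetP => B; rewrite diff_blocksE => /andP[].
move=> + jk; rewrite gate_mx_sub => nz.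
apply: ndiff_lt => //; apply: contraNN nz => rk.
apply/eqP/big1 => B /andP[bB jB].
suff -> : (gate B k == j) = (gate B r == j) by rewrite subrr mulr0.
have h u v : conn (setT :\ j) u v -> gate B v != j -> gate B u != j.
  move=> uv gv; apply: (conn_gate_neq g_strong bB (gate_in g_strong v bB) gv).
  apply: connect_trans uv _; apply: conn_gate => //.
  by rewrite gate_id // eq_sym.
apply/idP/idP; apply: contraTT; apply: h => //; by rewrite conn_sym.
Qed.

(** * Invertible scalars and the product of [C_mx] with [gate_mx] *)

Hypothesis D_unit : addmult_dist_mx g a Ms \in unitmx.

(** A vertex [r] is required: for [n = 0] the determinant is 1 but [excess] is an empty sum. *)
Lemma det_addmult_dist_mx (r : 'I_n) :
  \det (addmult_dist_mx g a Ms) = kappa g a Ms * excess.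
Proof.
by rewrite addmult_dist_mx_factor det_mulmx (det_gate_mx r) mulrCA mulrC.
Qed.

Lemma kappa_unit (r : 'I_n) : kappa g a Ms \is a GRing.unit.
Proof.
by move: D_unit; rewrite unitmxE (det_addmult_dist_mx r) unitrM => /andP[].
Qed.

Lemma excess_unit (r : 'I_n) : excess \is a GRing.unit.
Proof.
by move: D_unit; rewrite unitmxE (det_addmult_dist_mx r) unitrM => /andP[].
Qed.

(** Two vertices make every block have at least two, so [a B] occurs in [kappa] with positive
    exponent. *)
Lemma scale_unit B (i j : 'I_n) : i != j -> B \in blocks -> a B \is a GRing.unit.
Proof.
move=> ij bB; have := kappa_unit i; rewrite /kappa unitrM => /andP[_].
rewrite (bigD1 B) //= unitrM => /andP[+ _].
have : (0 < #|B| - 1)%N by rewrite subn_gt0 (block_gt1 g_strong bB ij).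
by case: (#|B| - 1)%N => // m _; rewrite exprS unitrM => /andP[].
Qed.

(** On a single vertex the additive matrix is zero, hence not invertible. *)
Lemma exists_neq (r : 'I_n) : exists s, r != s.
Proof.
apply/existsP; apply: contraT; rewrite negb_exists => /forallP all_r.
have eq_r s : s = r by apply/esym/eqP; rewrite -[_ == _]negbK all_r.
suff D0 : addmult_dist_mx g a Ms = 0.
  have /matrixP/(_ r r)/eqP := mulmxV D_unit.
  by rewrite D0 mul0mx !mxE eqxx eq_sym oner_eq0.
apply/matrixP => i j; rewrite (eq_r i) (eq_r j) addmult_dist_mxE mxE.
by apply: big1 => B bB; rewrite Ms_gate // subrr !mulr0.
Qed.

Lemma C_mxE i j : C_mx g a Ms i j = beta g a Ms i
  - \sum_(A in blocks | i \in A) (a A)^-1 * (gate A j != i)%:R.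
Proof.
rewrite mxE; have [->|ji] := eqVneq j i.
  by rewrite big1 ?subr0 // => A /andP[bA iA]; rewrite gate_id // eqxx mulr0.
have inb A : A \in blocks -> i \in A -> (j \in branch g i A) = (gate A j != i).
  by move=> bA iA; rewrite branchE // in_setU1 (negPf ji) in_set.
case: pickP => [B /andP[bB /andP[iB]]|no]; last first.
  have [B bB /andP[iB gj]] := gate_toward g_strong ji.
  by have := no B; rewrite bB iB inb // gj.
rewrite inb // => gj; congr (_ - _).
rewrite -(sum_toward (fun A => (a A)^-1) bB iB gj).
by apply: eq_bigr => A _; rewrite mulrC.
Qed.

(** Regrouped by blocks, [A] loses only its term at [i], while any other block has one gate in [A]
    and is counted wholly or not at all. *)
Lemma branch_sum A i k : A \in blocks -> i \in A ->
  \sum_j (gate A j != i)%:R * gate_mx j k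
  = \sum_(F in blocks | F \subset branch g i A) block_excess F
    - a A * ((gate A k == i)%:R - block_tau A i).
Proof.
move=> bA iA; under eq_bigr => j _ do rewrite mxE mulr_sumr.
have sumB B : B \in blocks ->
    \sum_(j in B) a B * ((gate B k == j)%:R - block_tau B j) = block_excess B.
  move=> bB; rewrite -mulr_sumr sumrB; congr (_ * (_ - _)).
  rewrite -[RHS](sum_gate_delta k (fun=> 1) bB).
  by apply: eq_bigr => j _; rewrite mul1r.
rewrite exchange_blocks big_mkcondr (bigD1 A) // [in RHS](bigD1 A) //=.
have -> : A \subset branch g i A.
  rewrite branchE //; apply/subsetP => x xA.
  by rewrite in_setU1 in_set gate_id // orbN.
rewrite addrAC; congr (_ + _).
  rewrite -sumB // (bigD1 i) //= gate_id // eqxx mul0r add0r.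
  rewrite [X in X - _](bigD1 i) //= addrAC subrr add0r.
  by apply: eq_bigr => j /andP[jA ji]; rewrite gate_id // ji mul1r.
apply: eq_bigr => B /andP[bB]; rewrite eq_sym => nAB.
have /set0Pn[b bI] := block_neq0 bB.
rewrite (sub_branch g_strong bA bB nAB iA bI).
have h j : j \in B -> gate A j = gate A b.
  by move=> jB; apply: (gate_const g_strong bA bB nAB).
have [e|e] := eqVneq (gate A b) i.
  by apply: big1 => j jB; rewrite h // e eqxx mul0r.
by rewrite -sumB //; apply: eq_bigr => j jB; rewrite h // e mul1r.
Qed.

Lemma betaE i : beta g a Ms i = excess^-1 *
  \sum_(A in blocks | i \in A) (a A)^-1 *
    \sum_(F in blocks | F \subset branch g i A) block_excess F.
Proof.
have [j ij] := exists_neq i; rewrite /beta; congr (_ * _).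
  rewrite (det_addmult_dist_mx i) invrM ?(kappa_unit i) ?(excess_unit i) //.
  by rewrite mulrCA mulrV ?mulr1 ?(kappa_unit i).
apply: eq_bigr => A _; congr (_ * _); apply: eq_bigr => F /andP[bF _].
exact/block_excessE/(scale_unit ij).
Qed.

(** The [beta] part cancels the branch sums of excesses, leaving at [i] the block sums that
    [tau_outE] and rebasing at [k] identify. *)
Lemma C_mul_gate_mx i k : (C_mx g a Ms *m gate_mx) i k = (i == k)%:R - t i.
Proof.
have [j ij] := exists_neq i.
rewrite mxE; under eq_bigr do rewrite C_mxE mulrBl mulr_suml.
rewrite sumrB -mulr_sumr gate_mx_colsum betaE mulrAC mulVr ?(excess_unit i) // mul1r.
rewrite exchange_big /= -sumrB tau_outE (sum_block_tau_rebase k).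
rewrite [k == i]eq_sym opprD addrA subrr add0r -sumrN; apply: eq_bigr => A /andP[bA iA].
under [X in _ - X]eq_bigr do rewrite -mulrA.
rewrite -mulr_sumr branch_sum // -mulrBr opprB addrA addrAC subrr add0r.
by rewrite mulrA mulVr ?mul1r ?opprB // (scale_unit ij).
Qed.

End Inverse.

Theorem theorem3 (R : comUnitRingType) (n : nat) (g : rel 'I_n)
    (a : {set 'I_n} -> R) (Ms : {set 'I_n} -> 'M[R]_n)
    (g_simple : irreflexive g) (g_strong : strongly_connected g)
    (Ms_diag : unit_diagonals g Ms)
    (D_unit : addmult_dist_mx g a Ms \in unitmx)
    (Ms_unit : mult_dist_mx g Ms \in unitmx) :
  invmx (addmult_dist_mx g a Ms)
  = (kappa g a Ms / \det (addmult_dist_mx g a Ms))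
      *: (tau_out g Ms *m tau_in_tr g Ms)
    + C_mx g a Ms *m invmx (mult_dist_mx g Ms).
Proof.
set X := RHS; suff XD : X *m addmult_dist_mx g a Ms = 1%:M.
  by rewrite -[RHS](mulmxK D_unit) XD mul1mx.
(* The row index [i] supplies the vertex that the unit lemmas require. *)
apply/matrixP => i k.
have tU := excess_unit g_strong Ms_diag Ms_unit D_unit i.
have kU := kappa_unit g_strong Ms_diag Ms_unit D_unit i.
rewrite /X (det_addmult_dist_mx a g_strong Ms_diag Ms_unit i).
rewrite (addmult_dist_mx_factor a g_strong Ms_diag Ms_unit).
have tauD : tau_in_tr g Ms *m (mult_dist_mx g Ms *m gate_mx g a Ms)
    = excess g a Ms *: const_mx 1.
  rewrite /tau_in_tr mulmxA mulmxKV //; apply/matrixP => l m.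
  rewrite mxE [RHS]mxE mxE mulr1 -(gate_mx_colsum a Ms g_strong m).
  by apply: eq_bigr => j _; rewrite mxE mul1r.
rewrite mulmxDl -scalemxAl -mulmxA tauD mulmxA mulmxKV // mxE.
rewrite (C_mul_gate_mx g_strong Ms_diag Ms_unit D_unit) -scalemxAr scalerA mxE.
(* The scalar [kappa / (kappa * excess) * excess] is 1, so the first term is the entry of [tau_out]
   that the second term subtracts. *)
rewrite invrM // mulrCA mulrV // mulr1 mulVr // mul1r.
by rewrite [X in X + _]mxE big_ord1 [const_mx _ _ _]mxE mulr1 addrC subrK mxE.
Qed.
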